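(* Let $T$ be a competitive map on a rectangular region $\mathcal{R}\subset\mathbb{R}^2$. Let $\overline{\mathrm{x}}\in\mathcal{R}$ be a fixed point of $T$ such that $\Delta:=\mathcal{R}\cap \mathrm{int}\,(\mathcal{Q}_1(\overline{\mathrm{x}})\cup\mathcal{Q}_3(\overline{\mathrm{x}}))$ is nonempty, and $T$ is strongly competitive on $\Delta$. Suppose that $T$ has a $C^1$ extension to a neighborhood of $\overline{\mathrm{x}}$, and that the Jacobian $J_T(\overline{\mathrm{x}})$ has real eigenvalues $\lambda,\mu$ with $0<|\lambda|<\mu$, $|\lambda|<1$, whose eigenspace $E^\lambda$ associated with $\lambda$ is not a coordinate axis. Let $\mathcal{C}$ be the invariant curve of $T$ through $\overline{\mathrm{x}}$ associated with $\lambda$ (as described in the context). For $\mathcal{C}$ to have endpoints in $\partial\mathcal{R}$, it is sufficient that at least one of the following conditions is satisfied. (i) The map $T$ has no fixed points nor periodic points of minimal period two in $\Delta$. (ii) The map $T$ has no fixed points in $\Delta$, $\det J_T(\overline{\mathrm{x}})>0$, and $T(\mathrm{x})=\overline{\mathrm{x}}$ has no solutions $\mathrm{x}\in\Delta$. (iii) The map $T$ has no points of minimal period two in $\Delta$, $\det J_T(\overline{\mathrm{x}})<0$, and $T(\mathrm{x})=\overline{\mathrm{x}}$ has no solutions $\mathrm{x}\in\Delta$.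
   Context: A region $\mathcal{R}\subset\mathbb{R}^2$ is rectangular if it is the cartesian product of two (nondegenerate) intervals in $\mathbb{R}$. A map on $\mathcal{R}$ is a continuous function $T:\mathcal{R}\to\mathcal{R}$; write $T=(f,g)$. $T$ is competitive if $f(x,y)$ is non-decreasing in $x$ and non-increasing in $y$, and $g(x,y)$ is non-increasing in $x$ and non-decreasing in $y$. It is strongly competitive (on a set) if these coordinate-wise monotonicities are strict (on that set). For $(x,y)\in\mathbb{R}^2$: $\mathcal{Q}_1(x,y)=\{(u,v):u\ge x,\ v\ge y\}$, $\mathcal{Q}_3(x,y)=\{(u,v):u\le x,\ v\le y\}$. A set $\mathcal{A}$ is invariant if $T(\mathcal{A})\subset\mathcal{A}$. A minimal period-two point is $\mathrm{x}$ with $T^2(\mathrm{x})=\mathrm{x}\neq T(\mathrm{x})$. The curve $\mathcal{C}$: under the stated hypotheses there exists a curve $\mathcal{C}\subset\mathcal{R}$ through $\overline{\mathrm{x}}$ that is invariant, is contained in the basin of attraction $\{\mathrm{y}\in\mathcal{R}:T^n(\mathrm{y})\to\overline{\mathrm{x}}\}$ of $\overline{\mathrm{x}}$, is tangential to $E^\lambda$ at $\overline{\mathrm{x}}$, and is the graph of a strictly increasing continuous function of the first coordinate on a nondegenerate interval; any endpoints of $\mathcal{C}$ in $\mathrm{int}\,\mathcal{R}$ are fixed points or minimal period-two points of $T$, and in the latter case the set of endpoints is a minimal period-two orbit. $\mathcal{C}$ denotes the curve with these properties that is maximal with respect to inclusion. Its endpoints are the limits of its points $(t,\varphi(t))$ as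 $t$ tends to the ends of the interval of definition (they need not belong to $\mathcal{C}$); ''$\mathcal{C}$ has endpoints in $\partial\mathcal{R}$'' means that no finite endpoint of $\mathcal{C}$ lies in $\mathrm{int}\,\mathcal{R}$, where ends at infinity are allowed. The point $\overline{\mathrm{x}}$ may be an endpoint of $\mathcal{C}$ if $\overline{\mathrm{x}}\in\partial\mathcal{R}$. *)

(* Defs.v *)
From HB Require Import structures.
From mathcomp Require Import all_boot all_order all_algebra.
From mathcomp Require Import all_classical all_reals all_analysis.
Set Implicit Arguments.
Unset Strict Implicit.
Unset Printing Implicit Defensive.
Import Order.TTheory GRing.Theory Num.Theory.
Import numFieldNormedType.Exports.
Local Open Scope classical_set_scope.
Local Open Scope ring_scope.

(* The plane is 'rV[R]_2, so that jacobian and eigenspace apply directly. *)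
Section Plane.
Variable R : realType.
Local Notation plane := 'rV[R]_2.

Definition pt (x y : R) : plane := \row_(j < 2) (if j == 0 then x else y).
Definition fstc (p : plane) : R := p 0 0.
Definition sndc (p : plane) : R := p 0 1.

Definition nondegenerate_interval (I : set R) : Prop :=
  is_interval I /\ exists a b, [/\ I a, I b & a < b].

Definition rectangular (A : set plane) : Prop :=
  exists I J : set R, [/\ nondegenerate_interval I, nondegenerate_interval J
    & A = [set p | I (fstc p) /\ J (sndc p)]].

(* Only the values of T on A matter. *)
Definition map_on (A : set plane) (T : plane -> plane) : Prop :=
  T @` A `<=` A /\ {within A, continuous T}.

Definition competitive_on (A : set plane) (T : plane -> plane) : Prop :=
  (forall x x' y, A (pt x y) -> A (pt x' y) -> x <= x' ->
     fstc (T (pt x y)) <= fstc (T (pt x' y)) /\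
     sndc (T (pt x' y)) <= sndc (T (pt x y))) /\
  (forall x y y', A (pt x y) -> A (pt x y') -> y <= y' ->
     fstc (T (pt x y')) <= fstc (T (pt x y)) /\
     sndc (T (pt x y)) <= sndc (T (pt x y'))).

Definition strongly_competitive_on (A : set plane) (T : plane -> plane) : Prop :=
  (forall x x' y, A (pt x y) -> A (pt x' y) -> x < x' ->
     fstc (T (pt x y)) < fstc (T (pt x' y)) /\
     sndc (T (pt x' y)) < sndc (T (pt x y))) /\
  (forall x y y', A (pt x y) -> A (pt x y') -> y < y' ->
     fstc (T (pt x y')) < fstc (T (pt x y)) /\
     sndc (T (pt x y)) < sndc (T (pt x y'))).

Definition competitive_map (A : set plane) (T : plane -> plane) : Prop :=
  map_on A T /\ competitive_on A T.

Definition Q1 (p : plane) : set plane :=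
  [set q | fstc p <= fstc q /\ sndc p <= sndc q].
Definition Q3 (p : plane) : set plane :=
  [set q | fstc q <= fstc p /\ sndc q <= sndc p].

Definition Delta (A : set plane) (xbar : plane) : set plane :=
  A `&` (Q1 xbar `|` Q3 xbar)°.

Definition fixed_point (A : set plane) (T : plane -> plane) (p : plane) : Prop :=
  A p /\ T p = p.

Definition minimal_period_two_point (A : set plane) (T : plane -> plane)
    (p : plane) : Prop :=
  [/\ A p, T (T p) = p & T p <> p].

Definition minimal_period_two_orbit (A : set plane) (T : plane -> plane)
    (O : set plane) : Prop :=
  exists p, minimal_period_two_point A T p /\ O = [set p; T p].

Definition invariant (T : plane -> plane) (C : set plane) : Prop :=
  T @` C `<=` C.

Definition basin (A : set plane) (T : plane -> plane) (xbar : plane) : set plane :=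
  [set y | A y /\ (fun n : nat => iter n T y) @ \oo --> xbar].

(* Te is a C^1 extension of T, given on A, to a neighborhood of p. Since A is a
   nondegenerate rectangle containing p, jacobian Te p depends only on T. *)
Definition C1_extension_near (A : set plane) (T : plane -> plane) (p : plane)
    (Te : plane -> plane) : Prop :=
  exists U : set plane, [/\ open U, U p,
    (forall q, U q -> differentiable Te q),
    (forall q, U q -> {for q, continuous (jacobian Te)}) &
    (forall q, U q -> A q -> Te q = T q)].

Definition curve (D : set R) (phi : R -> R) : set plane :=
  [set pt t (phi t) | t in D].

(* Finite endpoints only: an end of D at infinity, or at which phi is unbounded,
   contributes none. For a nondegenerate interval D, a punctured one-sided
   neighborhood of an end of D, on the side of D, is eventually inside D. *)
Definition curve_endpoints (D : set R) (phi : R -> R) : set plane :=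
  [set p | (has_lbound D /\ pt t (phi t) @[t --> (inf D)^'+] --> p) \/
           (has_ubound D /\ pt t (phi t) @[t --> (sup D)^'-] --> p)].

(* The tangent line at the point of abscissa t0 is spanned by (1, m), m being
   the derivative of phi relative to D (one-sided at an end of D); this covers
   every nonvertical line, and E is the row space of a matrix. *)
Definition tangential (D : set R) (phi : R -> R) (t0 : R) (E : 'M[R]_2) : Prop :=
  exists m : R,
    (phi t - phi t0) / (t - t0) @[t --> within D t0^'] --> m /\
    (pt 1 m <= E)%MS.

(* The points of 'rV_2 are row vectors: u *m jacobian F p = 'd F p u, so that
   jacobian F p is the transpose of the usual Jacobian matrix, and its
   eigenvectors as a matrix acting on rows are those of the differential. *)
Record stable_curve (A : set plane) (T : plane -> plane) (xbar : plane)
    (J : 'M[R]_2) (lambda : R) (D : set R) (phi : R -> R) : Prop := StableCurve {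
  sc_interval : nondegenerate_interval D;
  sc_continuous : {within D, continuous phi};
  sc_increasing : forall s t, D s -> D t -> s < t -> phi s < phi t;
  sc_subset : curve D phi `<=` A;
  sc_through : curve D phi xbar;
  sc_invariant : invariant T (curve D phi);
  sc_basin : curve D phi `<=` basin A T xbar;
  sc_tangential : tangential D phi (fstc xbar) (eigenspace J lambda);
  sc_endpoints : forall p, curve_endpoints D phi p -> A° p ->
    fixed_point A T p \/ minimal_period_two_point A T p;
  sc_endpoints_period_two : forall p, curve_endpoints D phi p -> A° p ->
    minimal_period_two_point A T p ->
    minimal_period_two_orbit A T (curve_endpoints D phi);
  (* xbar may be an endpoint only when it lies on the boundary of A *)
  sc_xbar : A° xbar -> ~ curve_endpoints D phi xbar }.

Definition maximal_stable_curve (A : set plane) (T : plane -> plane)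
    (xbar : plane) (J : 'M[R]_2) (lambda : R) (D : set R) (phi : R -> R) : Prop :=
  stable_curve A T xbar J lambda D phi /\
  forall (D' : set R) (phi' : R -> R), stable_curve A T xbar J lambda D' phi' ->
    curve D phi `<=` curve D' phi' -> curve D' phi' `<=` curve D phi.

End Plane.

(* Main.v *)
Require Import Defs.
From HB Require Import structures.
From mathcomp Require Import all_boot all_order all_algebra.
From mathcomp Require Import all_classical all_reals all_analysis.
From mathcomp Require Import ring lra.
Import Order.TTheory GRing.Theory Num.Theory.
Import numFieldNormedType.Exports.
Local Open Scope classical_set_scope.
Local Open Scope ring_scope.

(* A point p in the closure of C other than xbar lies strictly in Q1 or Q3 of
   xbar, because C is an increasing graph; so an endpoint in the interior of A
   lies in Delta, where it is a fixed or a minimal period-two point.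
   The derivative at t0 of the abscissa of T along C is lambda, as E^lambda is
   tangent to C. If T p = xbar has no solution in Delta, that abscissa never
   returns to t0, so by the intermediate value theorem T maps each of the two
   sides of C to itself (lambda > 0) or exchanges them (lambda < 0), and this
   passes to the closure. The first is incompatible with two endpoints, lying on
   different sides, that T exchanges; the second with a fixed endpoint. Since
   mu > 0, the sign of lambda is that of the determinant. *)

Set Implicit Arguments.
Unset Strict Implicit.

(** * Two-by-two determinants, and differentials along a filter *)

Lemma det_mx22 (K : comNzRingType) (M : 'M[K]_2) :
  \det M = M 0 0 * M 1 1 - M 0 1 * M 1 0.
Proof.
rewrite (expand_det_row M 0) !big_ord_recl big_ord0 addr0 /cofactor !det_mx11.
rewrite !mxE /= expr0 expr1 mul1r mulN1r mulrN.
by congr (_ * M _ _ - M _ _ * M _ _); apply: val_inj.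
Qed.

(** Subtracting the characteristic equations of [a] and [b] and cancelling [a - b] gives the trace
    as [a + b]; substituting for [b] then gives the determinant. *)
Lemma det_eigenvalues (K : fieldType) (M : 'M[K]_2) (a b : K) :
  eigenvalue M a -> eigenvalue M b -> a != b -> \det M = a * b.
Proof.
have char_poly2 c : eigenvalue M c ->
    (c - M 0 0) * (c - M 1 1) = M 0 1 * M 1 0.
  rewrite eigenvalue_root_char /root /char_poly det_mx22 !mxE /=.
  rewrite !(hornerE, mulr1n, mulr0n) => /eqP charM0.
  by apply/eqP; rewrite -subr_eq0 -charM0; apply/eqP; ring.
move=> /char_poly2 ha /char_poly2 hb ab; rewrite det_mx22 -ha.
have /eqP: (a - b) * (a + b - M 0 0 - M 1 1) = 0.
  by rewrite -[RHS](subrr (M 0 1 * M 1 0)) -{1}ha -hb; ring.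
rewrite mulf_eq0 subr_eq0 (negbTE ab) /= => /eqP trM.
have -> : b = M 0 0 + M 1 1 - a.
  by apply/eqP; rewrite -subr_eq0 -trM; apply/eqP; ring.
by ring.
Qed.

(** A chain rule for secants along any filter: in [f (x s) - f p], scaled by [(c s)^-1], the linear
    part converges because the differential is continuous, and the remainder is small relative to a
    bounded quantity. *)
Lemma cvg_diff_quotient (R : realType) (V W : normedModType R) (f : V -> W)
    (p v : V) (S : Type) (F : set_system S) (FF : Filter F)
    (x : S -> V) (c : S -> R) :
  differentiable f p -> (\forall s \near F, c s != 0) -> x @ F --> p ->
  (c s)^-1 *: (x s - p) @[s --> F] --> v ->
  (c s)^-1 *: (f (x s) - f p) @[s --> F] --> 'd f p v.
Proof.
move=> df c0 xp xv.
have /diff_locally/eqaddoP rest := df.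
have dxv : 'd f p ((c s)^-1 *: (x s - p)) @[s --> F] --> 'd f p v.
  by apply: cvg_comp xv _; have [/(_ v)] := iffLR (diff_locallyP p f) df.
apply: cvg_sub0 dxv; last first.
apply/cvgrPdist_le => /= e e0.
have v1 : 0 < `|v| + 1 by rewrite ltr_wpDl.
have xp0 : x s - p @[s --> F] --> (0 : V).
  by rewrite -(subrr p); apply: cvgB => //; exact: cvg_cst.
near=> s.
have cs : c s != 0 by near: s.
have ws : `|(c s)^-1 *: (x s - p)| <= `|v| + 1.
  near: s; have /cvgrPdist_lt /(_ 1 ltr01) := xv.
  apply: filterS => s h; rewrite -lerBlDl ltW//.
  by apply: le_lt_trans (lerB_dist _ _) _; rewrite distrC.
(* The scaled increments are eventually bounded by [|v| + 1], so this tolerance makes the scaled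
   remainder at most [e]. *)
have rs : `|f (x s) - f p - 'd f p (x s - p)| <=
    e / (`|v| + 1) * `|x s - p|.
  near: s; move: (xp0 _ (rest _ (divr_gt0 e0 v1))); rewrite nbhs_simpl /=.
  by apply: filterS => s /=; rewrite !fctE /= subrK opprD addrA.
rewrite sub0r normrN !fctE linearZ /=. rewrite -scalerBr normrZ.
apply: le_trans (ler_wpM2l (normr_ge0 _) rs) _.
rewrite mulrCA -normrZ; apply: le_trans (ler_wpM2l _ ws) _.
  by rewrite divr_ge0// ltW.
by rewrite divfK// gt_eqF.
Unshelve. all: by end_near. Qed.

(** * Coordinates and continuity in the plane *)

Section Plane.
Variable R : realType.
Implicit Types (p q : 'rV[R]_2) (D : set R) (phi : R -> R).

Lemma fstc_pt (x y : R) : fstc (pt x y) = x.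
Proof. by rewrite /fstc mxE. Qed.

Lemma sndc_pt (x y : R) : sndc (pt x y) = y.
Proof. by rewrite /sndc mxE. Qed.

Lemma pt_coord p : pt (fstc p) (sndc p) = p.
Proof.
apply/rowP => j; rewrite mxE /fstc /sndc.
by case: j => -[|[|//]] j2 /=; congr (p _ _); apply: val_inj.
Qed.

Lemma continuous_fstc : continuous (@fstc R).
Proof. exact: coord_continuous. Qed.

Lemma continuous_sndc : continuous (@sndc R).
Proof. exact: coord_continuous. Qed.

Lemma nbhs_coord p (I J : set R) : nbhs (fstc p) I -> nbhs (sndc p) J ->
  nbhs p [set q | I (fstc q) /\ J (sndc q)].
Proof.
move=> pI pJ.
have {}pI : nbhs p (@fstc R @^-1` I) by exact: continuous_fstc.
have {}pJ : nbhs p (@sndc R @^-1` J) by exact: continuous_sndc.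
exact: filterI.
Qed.

Lemma cvg_pt (S : Type) (F : set_system S) (FF : Filter F) (f g : S -> R)
    (a b : R) :
  f @ F --> a -> g @ F --> b -> pt (f s) (g s) @[s --> F] --> pt a b.
Proof.
(* A linear combination of two fixed vectors, so that convergence follows from the vector space
   operations. *)
have ptE x y : pt x y = x *: pt 1 0 + y *: pt 0 1.
  by apply/rowP => j; rewrite !mxE; case: eqP => _;
    rewrite !(mulr1, mulr0, addr0, add0r).
move=> fa gb; rewrite ptE.
under eq_fun do rewrite ptE.
by apply: cvgD; apply: cvgZr_tmp.
Qed.

Lemma within_continuous_compS (X Y Z : topologicalType) (B : set X)
    (E : set Y) (h : X -> Y) (g : Y -> Z) :
  h @` B `<=` E -> {within B, continuous h} -> {within E, continuous g} ->
  {within B, continuous g \o h}.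
Proof.
move=> hBE /subspace_continuousP ch /subspace_continuousP cg.
apply/subspace_continuousP => x Bx.
have Ehx : E (h x) by apply: hBE; exists x.
move=> P /(cg _ Ehx) /(ch _ Bx) near_gh.
(* A [within] filter is, by conversion, a neighborhood filter applied to an implication; later steps
   unfold it in the same way. *)
change (nbhs x (fun y => B y -> P (g (h y)))).
have {}near_gh : nbhs x (fun y => B y -> E (h y) -> P (g (h y))) := near_gh.
apply: filterS near_gh => y Pgh By.
by apply: Pgh => //; apply: hBE; exists y.
Qed.

(** Near [t0] the quotient has the sign of its limit [l]. Since [tau] avoids the value [t0] away
    from [t0], the intermediate value theorem carries this sign to all of each side of [D]. *)
Lemma quotient_limit_sign D (tau : R -> R) (t0 l : R) :
  is_interval D -> {within D, continuous tau} -> D t0 ->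
  (forall t, D t -> t != t0 -> tau t != t0) ->
  (tau t - t0) / (t - t0) @[t --> within D t0^'] --> l -> l != 0 ->
  forall s, D s -> s != t0 -> 0 < l * (tau s - t0) * (s - t0).
Proof.
move=> itvD ctau Dt0 tau_neq taul l0 s Ds st0.
have st : s - t0 != 0 by rewrite subr_eq0.
(* The segment from [t0] (at [d = 0]) to [s] (at [d = 1]) treats both sides of [t0] at once. *)
pose x d : R := t0 + d * (s - t0).
have cx : continuous x.
  move=> d; apply: cvgD; first exact: cvg_cst.
  by apply: cvgM; [exact: cvg_id|exact: cvg_cst].
have Dx d : 0 <= d <= 1 -> D (x d).
  move=> /andP[d0 d1]; rewrite /x; have [ts|] := leP t0 s.
    by apply: (itvD t0 s) => //; nra.
  by move=> ts; apply: (itvD s t0) => //; nra.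
have x_neq d : 0 < d -> x d != t0.
  by move=> d0; rewrite /x -subr_eq0 addrC addKr mulf_neq0// gt_eqF.
have ll : 0 < l * l by rewrite -expr2 exprn_even_gt0.
have near_sign : \forall t \near within D t0^',
    0 < l * ((tau t - t0) / (t - t0)).
  have ltaul : l * ((tau t - t0) / (t - t0)) @[t --> within D t0^'] --> l * l.
    by apply: cvgM => //; exact: cvg_cst.
  exact: (cvgr_gt _ ltaul).
have [d [d0 d1 xd]] : exists d, [/\ 0 < d, d < 1 &
    0 < l * ((tau (x d) - t0) / (x d - t0))].
  have near_x : \forall d \near 0^'+, x d != t0 -> D (x d) ->
      0 < l * ((tau (x d) - t0) / (x d - t0)).
    have x0 : x d @[d --> 0] --> t0.
      by have <- : x 0 = t0; [rewrite /x mul0r addr0|exact: cx].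
    have {}near_sign : nbhs t0 (fun t => t != t0 -> D t ->
      0 < l * ((tau t - t0) / (t - t0))) := near_sign.
    by apply: cvg_within; exact: x0 near_sign.
  near (0:R)^'+ => d; exists d; split.
  - by near: d; exact: nbhs_right_gt.
  - by near: d; exact: nbhs_right_lt.
  - have d0 : 0 < d by near: d; exact: nbhs_right_gt.
    have d1 : d <= 1 by near: d; exact: nbhs_right_le.
    have := x_neq d d0; have := Dx d; rewrite (ltW d0) d1 => /(_ isT).
    by move=> + xd; move: xd; near: d.
(* A wrong sign at [s] puts [tau (x d)] and [tau s] on opposite sides of [t0] in the weak sense, so
   [tau] takes the value [t0] at some [x c] with [d <= c <= 1]. *)
rewrite ltNge; apply/negP => taus.
have [||c] := @IVT R (tau \o x) d 1 t0 (ltW d1).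
- apply: (@within_continuous_compS _ _ _ _ D) => //.
    move=> _ [y /= /[!in_itv]/= /andP[dy y1] <-].
    by apply: Dx; rewrite y1 andbT; lra.
  exact: continuous_subspaceT.
- have x1 : x 1 = s by rewrite /x; ring.
  rewrite /= x1 ge_min le_max.
  have xdE : x d - t0 = d * (s - t0) by rewrite /x; ring.
  move: xd; rewrite xdE => xd.
  (* Multiplying by the positive [d * (s - t0) ^+ 2] clears the denominator and expresses the sign
     through [s - t0], as at [s]. *)
  have {}xd : 0 < l * (tau (x d) - t0) * (s - t0).
    have ds : 0 < d * (s - t0) ^+ 2 by rewrite mulr_gt0// exprn_even_gt0.
    have -> : l * (tau (x d) - t0) * (s - t0) =
        l * ((tau (x d) - t0) / (d * (s - t0))) * (d * (s - t0) ^+ 2).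
      by field; rewrite st gt_eqF.
    by rewrite mulr_gt0.
  have : (tau (x d) - t0) * (tau s - t0) <= 0.
    rewrite leNgt; apply/negP => h.
    have k : 0 < (l * (s - t0)) ^+ 2 by rewrite exprn_even_gt0//= mulf_neq0.
    by have := mulr_gt0 k h; nra.
  case: (leP (tau (x d)) t0) => ?; case: (leP (tau s) t0) => ? /=;
    by rewrite ?orbT //=; nra.
- rewrite in_itv /= => /andP[dc c1] /eqP; apply/negP; apply: tau_neq.
    by apply: Dx; rewrite c1 andbT; lra.
  by apply: x_neq; lra.
Unshelve. all: by end_near. Qed.

(** * Closure and endpoints of increasing curves *)

(** Strictness survives the passage to the closure because an abscissa [m] strictly between [fstc p]
    and [t0] leaves a margin between [phi m] and [phi t0]. If the abscissas agree, continuity at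
    [t0] forces the ordinates to agree. *)
Lemma closure_increasing_curve D phi (t0 : R) p :
  is_interval D -> {within D, continuous phi} ->
  (forall s t, D s -> D t -> s < t -> phi s < phi t) ->
  D t0 -> closure (curve D phi) p -> p <> pt t0 (phi t0) ->
  (t0 < fstc p /\ phi t0 < sndc p) \/ (fstc p < t0 /\ sndc p < phi t0).
Proof.
move=> itvD /subspace_continuousP cphi phi_lt Dt0 clp pNt0.
have near_curve (I J : set R) : nbhs (fstc p) I -> nbhs (sndc p) J ->
    exists t, [/\ D t, I t & J (phi t)].
  move=> pI pJ; have [_ [[t Dt <-]]] := clp _ (nbhs_coord pI pJ).
  by rewrite /= fstc_pt sndc_pt => -[It Jt]; exists t.
have [p_lt|p_gt|p_eq] := ltgtP (fstc p) t0.
- right; split => //; pose m := (fstc p + t0) / 2.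
  have [pm mt0] : fstc p < m /\ m < t0 by rewrite /m; lra.
  have [t [Dt /= tm _]] := near_curve _ setT (lt_nbhsl pm) filterT.
  have Dm : D m by apply: (itvD t t0) => //; rewrite !ltW.
  apply: le_lt_trans (phi_lt _ _ Dm Dt0 mt0).
  rewrite leNgt; apply/negP => phi_m.
  have [u [Du /= um]] := near_curve _ _ (lt_nbhsl pm) (lt_nbhsr phi_m).
  by apply/negP; rewrite -leNgt ltW// phi_lt.
- left; split => //; pose m := (fstc p + t0) / 2.
  have [pm mt0] : m < fstc p /\ t0 < m by rewrite /m; lra.
  have [t [Dt /= tm _]] := near_curve _ setT (lt_nbhsr pm) filterT.
  have Dm : D m by apply: (itvD t0 t) => //; rewrite !ltW.
  apply: lt_le_trans (phi_lt _ _ Dt0 Dm mt0) _.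
  rewrite leNgt; apply/negP => phi_m.
  have [u [Du /= um]] := near_curve _ _ (lt_nbhsr pm) (lt_nbhsl phi_m).
  by apply/negP; rewrite -leNgt ltW// phi_lt.
- case: pNt0; rewrite -[LHS]pt_coord p_eq; congr pt.
  apply/eqP; rewrite -subr_eq0 -normr_le0 leNgt; apply/negP => e0.
  (* Half the gap: an ordinate [phi u] within [e] of both [sndc p] and [phi t0] contradicts the
     triangle inequality. *)
  pose e := `|sndc p - phi t0| / 2; have {}e0 : 0 < e by rewrite /e; lra.
  have /cvgrPdist_lt /(_ e e0) phi_near := cphi _ Dt0.
  have {}phi_near : nbhs t0 (fun t => D t -> `|phi t0 - phi t| < e) := phi_near.
  rewrite -p_eq in phi_near.
  have [u [Du /= /(_ Du) ut]] := near_curve _ _ phi_near (nbhsx_ballx _ _ e0).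
  rewrite p_eq in ut; rewrite /ball /= => pu.
  have := ler_distD (phi u) (sndc p) (phi t0).
  by move: pu ut; rewrite (distrC (phi t0)) /e; lra.
Qed.

(** This makes the one-sided limits that define endpoints depend only on values of [phi] in [D].
    Nondegeneracy supplies a point of [D] strictly below [sup D]. *)
Lemma near_sup_interval D : nondegenerate_interval D -> has_ubound D ->
  \forall t \near (sup D)^'-, D t.
Proof.
move=> [itvD [a [b [Da Db ab]]]] ubD.
near=> t.
have [c Dc tc] : exists2 c, D c & t < c.
  apply: sup_gt; first by exists a.
  by near: t; exact: nbhs_left_lt.
apply: (itvD a c) => //; rewrite (ltW tc) andbT ltW//.
near: t; apply: nbhs_left_gt; apply: lt_le_trans ab _; exact: ub_le_sup.
Unshelve. all: by end_near. Qed.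

Lemma near_inf_interval D : nondegenerate_interval D -> has_lbound D ->
  \forall t \near (inf D)^'+, D t.
Proof.
move=> [itvD [a [b [Da Db ab]]]] lbD.
near=> t.
have [c Dc ct] : exists2 c, D c & c < t.
  apply: inf_lt; first by exists a.
  by near: t; exact: nbhs_right_gt.
apply: (itvD c b) => //; rewrite (ltW ct) /= ltW//.
near: t; apply: nbhs_right_lt; apply: le_lt_trans ab; exact: ge_inf.
Unshelve. all: by end_near. Qed.

Lemma curve_endpoints_closure D phi :
  nondegenerate_interval D -> curve_endpoints D phi `<=` closure (curve D phi).
Proof.
move=> ndD p pend U Up.
case: pend => -[bD phip].
  have phiU : \forall t \near (inf D)^'+, U (pt t (phi t)) := phip _ Up.
have [t [Dt Ut]] := @filter_ex _ (inf D)^'+ _ _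
    (filterI (near_inf_interval ndD bD) phiU).
  by exists (pt t (phi t)); split => //; exists t.
have phiU : \forall t \near (sup D)^'-, U (pt t (phi t)) := phip _ Up.
have [t [Dt Ut]] := @filter_ex _ (sup D)^'- _ _
  (filterI (near_sup_interval ndD bD) phiU).
by exists (pt t (phi t)); split => //; exists t.
Qed.

(** Limits are unique, so each end of [D] gives at most one endpoint; two distinct ones have
    abscissas [inf D] and [sup D], with [t0] between them. *)
Lemma curve_endpoints_separated D phi p q (t0 : R) : D t0 ->
  curve_endpoints D phi p -> curve_endpoints D phi q -> p <> q ->
  (fstc p - t0) * (fstc q - t0) <= 0.
Proof.
move=> Dt0.
have abscissa (F : set_system R) (FF : ProperFilter F) (e : R) r :
    F --> e -> pt t (phi t) @[t --> F] --> r -> fstc r = e.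
  move=> Fe Fr; apply: (cvg_unique (@norm_hausdorff _ _) _ Fe).
  have : fstc (pt t (phi t)) @[t --> F] --> fstc r.
    by apply: cvg_comp Fr _; exact: continuous_fstc.
  by under eq_fun do rewrite fstc_pt.
have inf_abscissa r : pt t (phi t) @[t --> (inf D)^'+] --> r -> fstc r = inf D.
  by apply: abscissa; exact: cvg_within.
have sup_abscissa r : pt t (phi t) @[t --> (sup D)^'-] --> r -> fstc r = sup D.
  by apply: abscissa; exact: cvg_within.
move=> [[lp pl]|[up pr]] [[lq ql]|[uq qr]] pq.
- by case: pq; apply: cvg_unique pl ql; exact: norm_hausdorff.
- rewrite (inf_abscissa _ pl) (sup_abscissa _ qr).
  by rewrite mulr_le0_ge0// (subr_le0, subr_ge0) (ge_inf, ub_le_sup).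
- rewrite (sup_abscissa _ pr) (inf_abscissa _ ql).
  by rewrite mulr_ge0_le0// (subr_le0, subr_ge0) (ge_inf, ub_le_sup).
- by case: pq; apply: cvg_unique pr qr; exact: norm_hausdorff.
Qed.

Lemma strict_quadrant_Delta A xbar p : A p ->
  (fstc xbar < fstc p /\ sndc xbar < sndc p) \/
  (fstc p < fstc xbar /\ sndc p < sndc xbar) -> Delta A xbar p.
Proof.
move=> Ap quadrant; split => //; rewrite /interior.
case: quadrant => -[x1 x2].
  have := nbhs_coord (lt_nbhsr x1) (lt_nbhsr x2).
  by apply: filterS => q [/= q1 q2]; left; split; exact: ltW.
have := nbhs_coord (lt_nbhsl x1) (lt_nbhsl x2).
by apply: filterS => q [/= q1 q2]; right; split; exact: ltW.
Qed.

(** * The stable curve and the action of [T] on its two sides *)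

Lemma stable_curve_through (A : set 'rV[R]_2) T xbar J (lambda : R) D phi :
  stable_curve A T xbar J lambda D phi ->
  D (fstc xbar) /\ xbar = pt (fstc xbar) (phi (fstc xbar)).
Proof. by move=> /sc_through[t Dt <-]; rewrite fstc_pt. Qed.

Lemma stable_curve_quadrant (A : set 'rV[R]_2) T xbar J (lambda : R) D phi p :
  stable_curve A T xbar J lambda D phi ->
  closure (curve D phi) p -> p <> xbar ->
  (fstc xbar < fstc p /\ sndc xbar < sndc p) \/
  (fstc p < fstc xbar /\ sndc p < sndc xbar).
Proof.
move=> C clp pxbar; have [Dt0 xbarE] := stable_curve_through C.
rewrite xbarE !fstc_pt sndc_pt; apply: closure_increasing_curve clp _ => //.
- by case: (sc_interval C).
- exact: (sc_continuous C).
- exact: (sc_increasing C).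
- by rewrite -xbarE.
Qed.

(** The tangent vector [pt 1 m] is an eigenvector for [lambda], so the differential sends it to a
    vector whose first coordinate is [lambda]. *)
Lemma stable_curve_quotient (A : set 'rV[R]_2) T Te xbar (lambda : R) D phi :
  T xbar = xbar -> C1_extension_near A T xbar Te ->
  stable_curve A T xbar (jacobian Te xbar) lambda D phi ->
  (fstc (T (pt t (phi t))) - fstc xbar) / (t - fstc xbar)
    @[t --> within D (fstc xbar)^'] --> lambda.
Proof.
move=> Txbar [U [openU Uxbar dTe _ TeT]] C.
have [Dt0 xbarE] := stable_curve_through C.
set t0 := fstc xbar in Dt0 xbarE *.
have [m [slope /eigenspaceP eigen]] := sc_tangential C.
rewrite -/t0 in slope.
have t_neq : \forall t \near within D t0^', t != t0.
  have h : nbhs t0 (fun t => t != t0 -> D t -> t != t0) by exact: filterE.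
  exact: h.
have tD : \forall t \near within D t0^', D t.
  have h : nbhs t0 (fun t => t != t0 -> D t -> D t) by exact: filterE.
  exact: h.
have tt0 : t @[t --> within D t0^'] --> t0.
  by apply: cvg_trans; first exact: cvg_within; exact: cvg_within.
have phit0 : phi t @[t --> within D t0^'] --> phi t0.
  have /subspace_continuousP /(_ _ Dt0) := sc_continuous C.
  apply: cvg_trans; apply: cvg_app => P.
  have punctured : nbhs t0 (fun t => D t -> P t) ->
      nbhs t0 (fun t => t != t0 -> D t -> P t) by apply: filterS => t h _.
  exact: punctured.
have xt : pt t (phi t) @[t --> within D t0^'] --> xbar.
  by rewrite xbarE; exact: cvg_pt.
(* Secants from [xbar], normalized to have first coordinate 1, tend to the tangent vector. *)
have wt : (t - t0)^-1 *: (pt t (phi t) - xbar)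
    @[t --> within D t0^'] --> pt 1 m.
  have w1 : pt 1 ((phi t - phi t0) / (t - t0))
      @[t --> within D t0^'] --> pt 1 m.
    by apply: cvg_pt => //; exact: cvg_cst.
  apply: cvg_trans w1; apply: near_eq_cvg.
  near=> t; have tt : t - t0 != 0 by rewrite subr_eq0; near: t.
  rewrite xbarE; apply/rowP => j; rewrite !mxE.
  by case: eqP => _; rewrite mulrC// divff.
have c_neq : \forall t \near within D t0^', t - t0 != 0.
  by apply: filterS t_neq => t; rewrite subr_eq0.
have Te_quotient : (t - t0)^-1 *: (Te (pt t (phi t)) - Te xbar)
    @[t --> within D t0^'] --> 'd Te xbar (pt 1 m).
  by apply: cvg_diff_quotient => //; exact: dTe.
move: Te_quotient.
have -> : 'd Te xbar (pt 1 m) = lambda *: pt 1 m.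
  by rewrite -eigen -deriveEjacobian ?deriveE//; exact: dTe.
move=> /(cvg_comp _ _) /(_ (@continuous_fstc _)).
have -> : fstc (lambda *: pt 1 m) = lambda by rewrite /fstc !mxE mulr1.
apply: cvg_trans; apply: near_eq_cvg; near=> t => /=.
(* The differential belongs to [Te]; the curve lies in [A], where [Te] agrees with [T] near
   [xbar]. *)
have TeTt : Te (pt t (phi t)) = T (pt t (phi t)).
  apply: TeT; first by near: t; apply: xt; exact: open_nbhs_nbhs.
  by apply: (sc_subset C); exists t => //; near: t.
have Tex : Te xbar = xbar.
  by rewrite TeT//; rewrite xbarE; apply: (sc_subset C); exists t0.
by rewrite TeTt Tex /fstc !mxE mulrC.
Unshelve. all: by end_near. Qed.

Lemma stable_curve_sign (A : set 'rV[R]_2) T Te xbar (lambda : R) D phi :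
  map_on A T -> T xbar = xbar -> C1_extension_near A T xbar Te ->
  stable_curve A T xbar (jacobian Te xbar) lambda D phi -> lambda != 0 ->
  (forall p, Delta A xbar p -> T p <> xbar) ->
  forall s, D s -> s != fstc xbar ->
  0 < lambda * (fstc (T (pt s (phi s))) - fstc xbar) * (s - fstc xbar).
Proof.
move=> [_ cT] Txbar hTe C lambda0 noT.
have [Dt0 xbarE] := stable_curve_through C.
have itvD : is_interval D by case: (sc_interval C).
apply: (@quotient_limit_sign D (fun t => fstc (T (pt t (phi t))))) => //.
(* The composition passes through [A], the only set on which [T] is known to be continuous. *)
- apply: (@within_continuous_compS _ _ _ _ setT _ (@fstc R)) => //; last first.
    by apply: continuous_subspaceT; exact: continuous_fstc.
  apply: (@within_continuous_compS _ _ _ _ A _ T) => //.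
    by move=> _ [t Dt <-]; apply: (sc_subset C); exists t.
  have /subspace_continuousP cphi := sc_continuous C.
  apply/subspace_continuousP => t Dt.
  by apply: cvg_pt; [exact: cvg_within|exact: cphi].
- move=> t Dt tt0; apply/eqP => Tt0.
  have At : A (pt t (phi t)) by apply: (sc_subset C); exists t.
  apply: (noT (pt t (phi t))).
    apply/strict_quadrant_Delta/(stable_curve_quadrant C) => //.
      by apply: subset_closure; exists t.
    by move=> pE; move: tt0; rewrite -pE fstc_pt eqxx.
  (* By invariance the image lies on a graph, so having the abscissa of [xbar] makes it equal to
     [xbar]. *)
  have [u Du uE] : curve D phi (T (pt t (phi t))).
    by apply: (sc_invariant C); exists (pt t (phi t)) => //; exists t.
  by move: Tt0; rewrite -uE fstc_pt => ->.
- exact: stable_curve_quotient Txbar hTe C.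
Qed.

(** Endpoints need not lie on the curve. By continuity of [T] on [A], a negative value at [p] would
    persist at nearby curve points, where the product is positive, or zero at [xbar]. *)
Lemma stable_curve_closure_sign (A : set 'rV[R]_2) T Te xbar (lambda : R)
    D phi :
  map_on A T -> T xbar = xbar -> C1_extension_near A T xbar Te ->
  stable_curve A T xbar (jacobian Te xbar) lambda D phi -> lambda != 0 ->
  (forall p, Delta A xbar p -> T p <> xbar) ->
  forall p, A p -> closure (curve D phi) p ->
  0 <= lambda * (fstc (T p) - fstc xbar) * (fstc p - fstc xbar).
Proof.
move=> mT Txbar hTe C lambda0 noT p Ap clp.
have [_ /subspace_continuousP cT] := mT.
rewrite leNgt; apply/negP => sign_p.
have cvg_sign : lambda * (fstc (T q) - fstc xbar) * (fstc q - fstc xbar)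
    @[q --> within A (nbhs p)] -->
    lambda * (fstc (T p) - fstc xbar) * (fstc p - fstc xbar).
  apply: cvgM; last first.
    apply: cvgB; last exact: cvg_cst.
    by apply: cvg_trans (@continuous_fstc p); apply: cvg_app; exact: cvg_within.
  apply: cvgM; first exact: cvg_cst.
  apply: cvgB; last exact: cvg_cst.
  by apply: cvg_comp (cT _ Ap) _; exact: continuous_fstc.
have near_neg : nbhs p (fun q => A q ->
    lambda * (fstc (T q) - fstc xbar) * (fstc q - fstc xbar) < 0).
  exact: (cvgr_lt _ cvg_sign _ sign_p).
have [_ [[t Dt <-]]] := clp _ near_neg.
have At : A (pt t (phi t)) by apply: (sc_subset C); exists t.
move=> /(_ At); rewrite fstc_pt; have [->|tt0] := eqVneq t (fstc xbar).
  by rewrite subrr mulr0 ltxx.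
by rewrite ltNge ltW// (stable_curve_sign mT Txbar hTe C).
Qed.
End Plane.

(** * Exclusion of endpoints interior to [A] *)

Unset Implicit Arguments.

Theorem theorem2 (R : realType) (A : set 'rV[R]_2) (T : 'rV[R]_2 -> 'rV[R]_2)
    (xbar : 'rV[R]_2) (Te : 'rV[R]_2 -> 'rV[R]_2) (lambda mu : R)
    (D : set R) (phi : R -> R)
    (hA : rectangular A)
    (hT : competitive_map A T)
    (hxbar : fixed_point A T xbar)
    (hDelta : Delta A xbar !=set0)
    (hstrong : strongly_competitive_on (Delta A xbar) T)
    (hTe : C1_extension_near A T xbar Te)
    (hlambda : eigenvalue (jacobian Te xbar) lambda)
    (hmu : eigenvalue (jacobian Te xbar) mu)
    (hlambda0 : 0 < `|lambda|) (hlambdamu : `|lambda| < mu)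
    (hlambda1 : `|lambda| < 1)
    (haxis : forall i : 'I_2,
       ~~ (eigenspace (jacobian Te xbar) lambda == (delta_mx 0 i : 'rV[R]_2))%MS)
    (hC : maximal_stable_curve A T xbar (jacobian Te xbar) lambda D phi)
    (hcond :
       [\/ (* (i) *)
           forall p, Delta A xbar p ->
             ~ fixed_point A T p /\ ~ minimal_period_two_point A T p,
           (* (ii) *)
           [/\ forall p, Delta A xbar p -> ~ fixed_point A T p,
               0 < \det (jacobian Te xbar) &
               forall p, Delta A xbar p -> T p <> xbar] |
           (* (iii) *)
           [/\ forall p, Delta A xbar p -> ~ minimal_period_two_point A T p,
               \det (jacobian Te xbar) < 0 &
               forall p, Delta A xbar p -> T p <> xbar]]) :
  forall p, curve_endpoints D phi p -> ~ A° p.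
Proof.
have [C _] := hC; have [mT _] := hT; have [_ Txbar] := hxbar.
have lambda0 : lambda != 0 by rewrite -normr_gt0.
(* The eigenvalues differ because [lambda <= |lambda| < mu]. *)
have detE : \det (jacobian Te xbar) = lambda * mu.
  apply: det_eigenvalues => //; apply/eqP => lmu.
  by move: hlambdamu; rewrite -lmu ltNge ler_norm.
have mu0 : 0 < mu by exact: lt_trans hlambdamu.
have clP := @curve_endpoints_closure R D phi (sc_interval C).
move=> p pend intp.
have Ap : A p by exact: interior_subset.
have pxbar : p <> xbar.
  by move=> pE; rewrite pE in pend intp; exact: (sc_xbar C).
have quadrantP q : curve_endpoints D phi q -> q <> xbar -> _ :=
  fun qend => stable_curve_quadrant C (clP _ qend).
have Dp := strict_quadrant_Delta Ap (quadrantP _ pend pxbar).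
have sign (noT : forall r, Delta A xbar r -> T r <> xbar) q :
    curve_endpoints D phi q -> A q ->
    0 <= lambda * (fstc (T q) - fstc xbar) * (fstc q - fstc xbar).
  move=> qend Aq.
  apply: (stable_curve_closure_sign mT Txbar hTe C) => //.
  exact: clP.
have [Dt0 _] := stable_curve_through C.
have abscissa q : curve_endpoints D phi q -> q <> xbar ->
    fstc q - fstc xbar != 0.
  move=> qend /(quadrantP q qend); rewrite subr_eq0 neq_lt.
  by move=> [[-> _]|[-> _]]; rewrite ?orbT.
(* For a fixed [p] only (iii) remains: there [lambda < 0], while the sign condition reads
   [0 <= lambda * (fstc p - fstc xbar) ^+ 2]. *)
have [fixp|perp] := sc_endpoints C pend intp.
  case: hcond => [/(_ p Dp)[]//|[/(_ p Dp)//]|[_ det0 noT]].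
  have lneg : lambda < 0 by rewrite -(pmulr_llt0 _ mu0) -detE.
  have := sign noT p pend Ap; case: fixp => _ ->.
  have px0 := abscissa p pend pxbar.
  have sq : 0 < (fstc p - fstc xbar) ^+ 2 by rewrite exprn_even_gt0.
  by apply/negP; rewrite -ltNge -mulrA -expr2 nmulr_rlt0.
(* For a period-two [p] only (ii) remains, and there [lambda > 0]. *)
case: hcond => [/(_ p Dp)[]//|[_ det0 noT]|[/(_ p Dp)//]].
have [_ TTp Tpp] := perp.
have lpos : 0 < lambda by rewrite -(pmulr_lgt0 _ mu0) -detE.
have ATp : A (T p) by apply: mT.1; exists p.
have Tpxbar : T p <> xbar by exact: noT.
(* The endpoints form a set [[set q; T q]] with [T (T q) = q], so [T] maps endpoints to
   endpoints. *)
have Tpend : curve_endpoints D phi (T p).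
  have [q [perq endsE]] := sc_endpoints_period_two C pend intp perp.
  move: pend; rewrite endsE => -[->|->]; first by right.
  by left; case: perq.
have := sign noT p pend Ap.
(* Distinct endpoints lie on opposite sides of [xbar], strictly since neither shares its abscissa; a
   positive [lambda] forbids this for [p] and [T p]. *)
have : (fstc (T p) - fstc xbar) * (fstc p - fstc xbar) < 0.
  rewrite lt_neqAle mulf_neq0 ?abscissa//=.
  exact: curve_endpoints_separated Dt0 Tpend pend Tpp.
by move=> neg; apply/negP; rewrite -ltNge -mulrA pmulr_rlt0.
Qed.
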